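(* Let $n,k$ be positive integers and let $d$ be a non-negative integer. Let $X \subseteq \mathbb{R}^n$ be a set with non-empty interior. Let $C \subseteq P_{n,2d}(X)$ be a closed convex cone such that there exist finite subsets $S$ of $X$ of arbitrarily large cardinality with the following property: for every $k$-element subset $T$ of $S$, some polynomial $f$ in the cone $C$ is equal to zero on $T$ and is strictly positive on $S \setminus T$. Then $\operatorname{sxdeg}(C) > k$.
   Context: $\mathbb{R}[\mathbf{x}]_{2d}$ denotes the finite-dimensional vector space of polynomials in $n$ variables $\mathbf{x}=(x_1,\ldots,x_n)$ with real coefficients and degree at most $2d$ (with its Euclidean topology). For $X\subseteq\mathbb{R}^n$, $P_{n,2d}(X) := \{ f \in \mathbb{R}[\mathbf{x}]_{2d} : f \ge 0 \text{ on } X\}$. $\mathcal{S}^j$ is the vector space of real symmetric $j\times j$ matrices and $\mathcal{S}_+^j\subseteq \mathcal{S}^j$ is the cone of positive semidefinite ones. For a closed convex cone $K$ in a finite-dimensional real vector space $E$, a subset $S$ of a real vector space $V$ has a $K$-lift if $S = \pi(K \cap H)$ for some affine subspace $H$ of $E$ and some linear map $\pi: E \to V$. The semidefinite extension degree $\operatorname{sxdeg}(S)$ is the smallest positive integer $j$ such that $S$ has an $(\mathcal{S}_+^j)^m$-lift for some finite positive integer $m$, where $(\mathcal{S}_+^j)^m = \mathcal{S}_+^j\times\cdots\times\mathcal{S}_+^j$ ($m$ factors); $\operatorname{sxdeg}(S):=\infty$ if there is no such $j$. *)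

(* Defs.v *)
From HB Require Import structures.
From mathcomp Require Import all_boot all_order all_algebra finmap.
From mathcomp Require Import all_classical all_reals all_analysis.
(* The notations of mpoly clash with those of MathComp-Analysis: below,
   mpoly n R is {mpoly R[n]}, bmultinom n b is 'X_{1..n < b}, mcoeff m p is
   p@_m and meval v p is p.@[v]. *)
From mathcomp Require Import -(notations) mpoly.

Set Implicit Arguments.
Unset Strict Implicit.
Unset Printing Implicit Defensive.

Import Order.TTheory GRing.Theory Num.Theory.
Import numFieldNormedType.Exports.

Local Open Scope classical_set_scope.
Local Open Scope ring_scope.

Section BoundedDegree.
Variables (n : nat) (R : realType) (e : nat).

(* msize is the total degree plus one, and 0 for the zero polynomial. *)
Definition deg_le : {pred mpoly n R} := [pred p | (msize p <= e.+1)%N].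

Lemma deg_le_submod_closed : submod_closed deg_le.
Proof.
split=> [|a p q]; rewrite !inE ?msize0// => pe qe.
rewrite (leq_trans (msizeD_le _ _))// geq_max qe andbT.
exact: leq_trans (msizeZ_le _ _) pe.
Qed.

HB.instance Definition _ :=
  GRing.isSubmodClosed.Build R (mpoly n R) deg_le deg_le_submod_closed.

Record bpoly := BPoly { bpoly_val :> mpoly n R; _ : bpoly_val \in deg_le }.

HB.instance Definition _ := [isSub for bpoly_val].
HB.instance Definition _ := [Choice of bpoly by <:].
HB.instance Definition _ := [SubChoice_isSubLmodule of bpoly by <:].

Definition bpoly_coefs (f : bpoly) : 'rV[R]_#|{: bmultinom n e.+1}| :=
  \row_i mcoeff (enum_val i : bmultinom n e.+1) f.

(* The Euclidean topology: bpoly_coefs is a linear bijection onto R^N. *)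
HB.instance Definition _ :=
  Topological.copy bpoly (initial_topology bpoly_coefs).

Definition bpoly_eval (f : bpoly) (x : 'rV[R]_n) : R :=
  meval (fun i => x ord0 i) f.

End BoundedDegree.

Definition nonneg_polys (R : realType) (n e : nat) (X : set 'rV[R]_n) :
    set (bpoly n R e) :=
  [set f | forall x, X x -> 0 <= bpoly_eval f x].
Arguments nonneg_polys {R n} e X.

Definition convex_cone (R : realType) (V : lmodType R) (C : set V) : Prop :=
  C !=set0 /\
  forall (a b : R) (x y : V), 0 <= a -> 0 <= b -> C x -> C y ->
    C (a *: x + b *: y).

Definition symmx (R : realType) (j : nat) : vectType R :=
  subvs_of (fixedSpace (linfun (@trmx R j j))).

Lemma mem_symmx (R : realType) (j : nat) (A : 'M[R]_j) :
  (A \in fixedSpace (linfun (@trmx R j j))) = (A^T == A).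
Proof. by apply/fixedSpaceP/eqP; rewrite lfunE. Qed.

Definition psd_cone (R : realType) (j : nat) : set (symmx R j) :=
  [set A | forall v : 'rV[R]_j, 0 <= (v *m vsval A *m v^T) 0 0].

Definition psd_cone_pow (R : realType) (j m : nat) :
    set {ffun 'I_m -> symmx R j} :=
  [set A | forall i, psd_cone (A i)].

Definition has_lift (R : realType) (E : vectType R) (K : set E)
    (V : lmodType R) (S : set V) : Prop :=
  exists (a : E) (L : {vspace E}) (p : {linear E -> V}),
    S = p @` (K `&` [set x | x - a \in L]).

Definition has_psd_lift (R : realType) (j : nat) (V : lmodType R)
    (S : set V) : Prop :=
  exists m : nat, (0 < m)%N /\ has_lift (@psd_cone_pow R j m) S.

(* Only positive integers and +oo occur as values. *)
Definition sxdeg (R : realType) (V : lmodType R) (S : set V) : \bar int :=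
  match pselect (exists j : nat, (0 < j)%N && `[< has_psd_lift j S >]) with
  | left ex_j => (Posz (ex_minn ex_j))%:E
  | right _ => +oo%E
  end.

(* Main.v *)
Require Import Defs.
From HB Require Import structures.
From mathcomp Require Import all_boot all_order all_algebra finmap.
From mathcomp Require Import all_classical all_reals all_analysis.
From mathcomp Require Import -(notations) mpoly.
From mathcomp Require Import zify ring lra.

Set Implicit Arguments.
Unset Strict Implicit.
Unset Printing Implicit Defensive.

Import Order.TTheory GRing.Theory Num.Theory.
Import numFieldNormedType.Exports.

Local Open Scope classical_set_scope.
Local Open Scope ring_scope.


(** Suppose that the cone C is the image under p of a section Q of a product
    of m cones of psd matrices of size j, with j <= k. Evaluating at a point x
    of X turns p into a linear form l_x that is nonnegative on Q, so the zeros
    of l_x in Q form a face of Q. A face of such a section is cut out by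
    kernels: if l_x vanishes at D and, block by block, the kernel of D is
    contained in that of B, then D can be pushed slightly away from B inside
    Q, and l_x B > 0 would make l_x negative there, so l_x B = 0
    ([psd_cone_pow_sub_face]).

    Given a finite set S as in the hypothesis, lift the polynomial attached to
    each k-element subset A of S to a point B A of Q. For x in S, let D x be
    the barycenter of the points B A over all A that contain x. Then l_x
    vanishes at D x, and each kernel of D x is contained in the corresponding
    kernel of every B A with x in A ([barycenter_psd_section]). The kernels of
    D x in the m blocks are subspaces of a space of dimension j. If S is large
    enough, one finds A with k elements and x outside A such that in every
    block the kernel of D x lies in the sum of the kernels of D y for y in A
    ([simultaneously_spanning_subfamily]); this is where j <= k is used. That
    sum lies in the kernel of B A, so l_x (B A) = 0. But the polynomial
    attached to A is strictly positive at x: a contradiction.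

    No conic duality enters this argument: kernels of points of Q play the
    role of the dual certificates. *)

(** * Positive semidefinite matrices and their kernels *)

Section PSD.
Variables (R : realFieldType) (j : nat).
Implicit Types A B D : 'M[R]_j.

Definition bform A (u v : 'rV[R]_j) : R := (u *m A *m v^T) 0 0.

Definition psd A := A^T = A /\ forall v, 0 <= bform A v v.

Lemma bformDl A u1 u2 v : bform A (u1 + u2) v = bform A u1 v + bform A u2 v.
Proof. by rewrite /bform !mulmxDl mxE. Qed.

Lemma bformDr A u v1 v2 : bform A u (v1 + v2) = bform A u v1 + bform A u v2.
Proof. by rewrite /bform raddfD mulmxDr mxE. Qed.

Lemma bformZl A a u v : bform A (a *: u) v = a * bform A u v.
Proof. by rewrite /bform -!scalemxAl mxE. Qed.

Lemma bformZr A a u v : bform A u (a *: v) = a * bform A u v.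
Proof. by rewrite /bform linearZ/= -scalemxAr mxE. Qed.

Lemma bform_sym A u v : A^T = A -> bform A u v = bform A v u.
Proof.
move=> sA; rewrite /bform.
have -> : u *m A *m v^T = (v *m A *m u^T)^T by rewrite !trmx_mul trmxK sA mulmxA.
by rewrite mxE.
Qed.

Lemma psd_cauchy_schwarz A u v :
  psd A -> bform A u v ^+ 2 <= bform A u u * bform A v v.
Proof.
move=> [sA A0]; set a := bform A u u; set b := bform A u v; set c := bform A v v.
have q s t : 0 <= s ^+ 2 * a + s * t * b *+ 2 + t ^+ 2 * c.
  have := A0 (s *: u + t *: v).
  rewrite !(bformDl, bformDr, bformZl, bformZr) (bform_sym v u sA) -/a -/b -/c.
  by congr (0 <= _); ring.
have a0 : 0 <= a := A0 u.
have c0 : 0 <= c := A0 v.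
have [c_gt0|c_le0] := ltP 0 c.
  rewrite -subr_ge0; have := q c (- b).
  have -> : c ^+ 2 * a + c * - b * b *+ 2 + (- b) ^+ 2 * c = c * (a * c - b ^+ 2) by ring.
  by rewrite pmulr_rge0.
have c00 : c = 0 by apply/le_anti; rewrite c_le0.
(* When c = 0, the pair (b, - (a + 1)) gives the value - (a + 2) * b ^ 2. *)
have := q b (- (a + 1)); rewrite c00 mulr0; nra.
Qed.

Lemma bform_delta A u i : bform A u (delta_mx 0 i) = (u *m A) 0 i.
Proof. by rewrite /bform trmx_delta -colE mxE. Qed.

(** Cauchy-Schwarz against the unit vectors. *)
Lemma psd_null A v : psd A -> bform A v v = 0 -> v *m A = 0.
Proof.
move=> pA v0; apply/rowP=> i; rewrite -bform_delta [RHS]mxE; apply/eqP.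
rewrite -sqrf_eq0 eq_le sqr_ge0 andbT.
by rewrite (le_trans (psd_cauchy_schwarz _ _ pA))// v0 mul0r.
Qed.

Lemma bform_addmx A B u v : bform (A + B) u v = bform A u v + bform B u v.
Proof. by rewrite /bform mulmxDr mulmxDl mxE. Qed.

Lemma bform_scalemx a A u v : bform (a *: A) u v = a * bform A u v.
Proof. by rewrite /bform -scalemxAr -scalemxAl mxE. Qed.

Lemma bform_summx (I : finType) (P : {pred I}) (A : I -> 'M[R]_j) u v :
  bform (\sum_(i in P) A i) u v = \sum_(i in P) bform (A i) u v.
Proof. by rewrite /bform mulmx_sumr mulmx_suml summxE. Qed.

(** On the kernel of the sum the nonnegative values of the forms add up to
    zero, so each of them is zero. *)
Lemma kermx_sum_psd (I : finType) (P : {pred I}) (A : I -> 'M[R]_j) i :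
  (forall i, i \in P -> psd (A i)) -> i \in P ->
  (kermx (\sum_(i in P) A i) <= kermx (A i))%MS.
Proof.
move=> pA Pi; apply/rV_subP=> v /sub_kermxP v0; apply/sub_kermxP.
apply: psd_null; first exact: pA.
have : bform (\sum_(i in P) A i) v v = 0 by rewrite /bform v0 mul0mx mxE.
rewrite bform_summx => /eqP; rewrite psumr_eq0; last by move=> l /pA[].
by move=> /allP/(_ i); rewrite mem_index_enum Pi => /(_ isT)/eqP.
Qed.

(** Since the row space of B is contained in that of D, a pseudo-inverse of D
    gives B = D *m Z *m D. Hence the form of B at v is the form of Z at
    w = v *m D, and Cauchy-Schwarz bounds each w_i ^+ 2 by D i i times the form
    of D at v. *)
Lemma psd_dominated B D : psd D -> B^T = B -> (kermx D <= kermx B)%MS ->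
  exists2 c, 0 <= c & forall v, bform B v v <= c * bform D v v.
Proof.
move=> pD sB kDB; have [sD D0] := pD.
have BD : (B <= D)%MS.
  rewrite submxE -[B in B *m _]sB -[cokermx D]trmxK -trmx_mul trmx_eq0.
  suff /submx_trans/(_ kDB)/sub_kermxP-> : ((cokermx D)^T <= kermx D)%MS by [].
  by apply/sub_kermxP; rewrite -[D in _ *m D]sD -trmx_mul mulmx_coker trmx0.
pose P := pinvmx D; pose Z := P^T *m B *m P.
have BE : B = D *m Z *m D.
  have B1 : B = B *m P *m D by rewrite mulmxKpV.
  have B2 : B = D *m P^T *m B by rewrite -[LHS]sB [in LHS]B1 !trmx_mul sB sD mulmxA.
  by rewrite [LHS]B1 [in LHS]B2 /Z !mulmxA.
exists (\sum_i \sum_l `|Z i l| * (D i i + D l l)).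
  have dD i : 0 <= D i i.
    have := D0 (delta_mx 0 i); rewrite bform_delta -rowE mxE; exact.
  by do 2![apply: sumr_ge0 => ? _]; rewrite mulr_ge0// addr_ge0.
move=> v; pose w := v *m D.
have w2 i : w 0 i ^+ 2 <= bform D v v * D i i.
  have := psd_cauchy_schwarz v (delta_mx 0 i) pD.
  by rewrite !bform_delta -rowE [row _ _ _ _]mxE.
have -> : bform B v v = \sum_i \sum_l w 0 i * Z i l * w 0 l.
  have -> : bform B v v = (w *m Z *m w^T) 0 0.
    by rewrite /bform {1}BE trmx_mul sD !mulmxA.
  rewrite mxE exchange_big/=; apply: eq_bigr => l _.
  by rewrite !mxE big_distrl.
rewrite mulr_suml; apply: ler_sum => i _; rewrite mulr_suml; apply: ler_sum => l _.
have := w2 i; have := w2 l; have := D0 v.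
set q := bform D v v; set a := w 0 i; set b := w 0 l => q0 bl ai.
apply: (le_trans (ler_norm _)); rewrite !normrM mulrAC mulrC -mulrA.
apply: ler_wpM2l => //.
have : 0 <= (`|a| - `|b|) ^+ 2 by exact: sqr_ge0.
rewrite sqrrB !real_normK ?num_real//.
have : 0 <= `|a| * `|b| by rewrite mulr_ge0.
nra.
Qed.

End PSD.

(** * Families of subspaces of a vector space of bounded dimension *)

Section Subspaces.
Variable F : fieldType.

(** Induction on the bound r for the dimension of a space W that contains all
    the U x. Either a subspace of dimension at most r, spanned by some of the
    U y, already contains many of the U x, and the induction hypothesis applies
    inside it; or a subset S' of S that is maximal for being in general
    position (each A in S' spans dimension at least the minimum of #|A| and
    r + 1) is large, because maximality forces every other x into one of the
    at most 2 ^ #|S'| small subspaces spanned by subsets of S'. In general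
    position r + 1 members span all of W. *)
Lemma spanning_subfamily (j r N : nat) : exists M : nat,
  forall (T : finType) (U : T -> 'M[F]_j) (S : {set T}) (W : 'M[F]_j),
    (\rank W <= r)%N -> (forall x, x \in S -> (U x <= W)%MS) ->
    (M <= #|S|)%N ->
  exists2 S' : {set T}, S' \subset S /\ (N <= #|S'|)%N &
    forall (A : {set T}) x, A \subset S' -> (r <= #|A|)%N -> x \in S' ->
      (U x <= \sum_(y in A) U y)%MS.
Proof.
elim: r => [|r [M IH]].
  exists N => T U S W; rewrite leqn0 mxrank_eq0 => /eqP-> UW NS.
  exists S => // A x _ _ /UW; rewrite submx0 => /eqP->; exact: sub0mx.
exists (N + 2 ^ N * M)%N => T U S W rW UW MS.
pose span (A : {set T}) := (\sum_(y in A) U y)%MS.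
pose inside (A : {set T}) := [set x in S | (U x <= span A)%MS].
have [/existsP[A /andP[rA MA]]|] :=
    boolP [exists A : {set T}, (\rank (span A) <= r)%N && (M <= #|inside A|)%N].
  have [|S' [S'S NS'] S'P] := IH T U (inside A) (span A) rA _ MA.
    by move=> x; rewrite inE => /andP[].
  exists S'.
    split=> //; apply: (fintype.subset_trans S'S).
    by apply/fintype.subsetP=> x; rewrite inE => /andP[].
  by move=> B x BS' /ltnW; exact: S'P.
move/existsPn=> few.
pose indep (S' : {set T}) := (S' \subset S) &&
  [forall A : {set T}, (A \subset S') ==> (minn #|A| r.+1 <= \rank (span A))%N].
have [|S' /maxsetP[/andP[S'S /forallP S'P] S'max] _] := @maxset_exists _ indep finset.set0.
  rewrite /indep finset.sub0set/=; apply/forallP=> A; apply/implyP.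
  by rewrite finset.subset0 => /eqP->; rewrite cards0 min0n.
exists S'.
  split=> //; rewrite leqNgt; apply/negP=> S'N.
  (* Elements of S outside S' and outside bad could be added to S'. *)
  pose bad := (\bigcup_(A in powerset S' | (\rank (span A) <= r)%N) inside A)%SET.
  have badM : (#|bad| <= 2 ^ N * M)%N.
    apply: (@leq_trans (\sum_(A in powerset S') M)).
      rewrite /bad big_mkcondr/=.
      elim/big_ind2: _ => [|n1 A1 n2 A2 le1 le2|A _]; first by rewrite cards0.
        by rewrite (leq_trans (leq_card_setU _ _).1)// leq_add.
      case: ifP => [rA|_]; last by rewrite cards0.
      by have := few A; rewrite rA/= -ltnNge => /ltnW.
    by rewrite sum_nat_const card_powerset leq_mul2r leq_exp2l// ltnW// orbT.
  have /subsetPn[x xS] : ~~ (S \subset S' :|: bad)%SET.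
    apply: contraL MS => /subset_leq_card le; rewrite -ltnNge.
    apply: (leq_ltn_trans le); apply: (leq_ltn_trans (leq_card_setU _ _).1).
    by rewrite -addSn leq_add.
  rewrite finset.in_setU negb_or => /andP[xS' xbad].
  suff /S'max : indep (x |: S')%SET.
    move=> /(_ (finset.subsetUr _ _)) /setP /(_ x).
    by rewrite finset.setU11 (negPf xS').
  apply/andP; split; first by rewrite finset.subUset finset.sub1set xS S'S.
  apply/forallP=> A; apply/implyP=> AxS'.
  have [xA|xA] := boolP (x \in A); last first.
    apply: (implyP (S'P A)); apply/fintype.subsetP => y yA.
    have /(fintype.subsetP AxS') := yA.
    by rewrite !inE => /predU1P[yx|//]; rewrite -yx yA in xA.
  have AS' : (A :\ x \subset S')%SET by rewrite finset.subDset.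
  have /implyP/(_ AS') rA := S'P (A :\ x)%SET.
  have spanA : (span A = U x + span (A :\ x)%SET)%MS by rewrite /span (big_setD1 x).
  rewrite spanA (cardsD1 x A) xA add1n.
  have [rAr|rAr] := leqP r.+1 (\rank (span (A :\ x)%SET)).
    by rewrite (leq_trans (geq_minr _ _))// (leq_trans rAr)// mxrankS// addsmxSr.
  have lt : (\rank (span (A :\ x)%SET) < \rank (U x + span (A :\ x)%SET)%MS)%N.
    rewrite ltn_neqAle mxrankS ?addsmxSr// andbT; apply: contra xbad => /eqP eqr.
    apply/bigcupP; exists (A :\ x)%SET; first by rewrite powersetE AS'.
    rewrite inE xS/=.
    have := mxrank_leqif_sup (addsmxSr (U x) (span (A :\ x)%SET)).
    move=> [_]; rewrite eqr eqxx => /esym; exact: submx_trans (addsmxSl _ _).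
  by lia.
move=> A x AS' rA xS'; have xS := fintype.subsetP S'S x xS'.
apply: (submx_trans (UW x xS)).
have AW : (span A <= W)%MS.
  by apply/sumsmx_subP=> y yA; apply/UW/(fintype.subsetP S'S)/(fintype.subsetP AS').
rewrite -(mxrank_leqif_sup AW).2 eqn_leq mxrankS//=.
have /implyP/(_ AS') := S'P A; rewrite (minn_idPr rA).
exact: leq_trans.
Qed.

(** The property of the preceding lemma passes to subfamilies, so it can be
    enforced for one index after another. *)
Lemma simultaneously_spanning_subfamily (j N : nat) (I : eqType) (s : seq I) :
  exists M : nat,
  forall (T : finType) (U : I -> T -> 'M[F]_j) (S : {set T}),
    (M <= #|S|)%N ->
  exists2 S' : {set T}, S' \subset S /\ (N <= #|S'|)%N &
    forall i (A : {set T}) x, i \in s -> A \subset S' -> (j <= #|A|)%N ->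
      x \in S' -> (U i x <= \sum_(y in A) U i y)%MS.
Proof.
elim: s => [|i s [M IH]]; first by exists N => T U S NS; exists S.
have [M' M'P] := spanning_subfamily j j M.
exists M' => T U S M'S.
have [||S1 [S1S MS1] S1P] := M'P T (U i) S 1%:M _ _ M'S.
- exact: rank_leq_row.
- by move=> x _; exact: submx1.
have [S2 [S2S1 NS2] S2P] := IH T U S1 MS1.
exists S2; first by split=> //; exact: fintype.subset_trans S1S.
move=> i' A x; rewrite inE => /predU1P[->|i's] AS2 jA xS2; last exact: S2P.
by apply: S1P => //; [exact: fintype.subset_trans S2S1|exact: (fintype.subsetP S2S1)].
Qed.
End Subspaces.

(** * Faces of sections of a product of psd cones *)

Section Sections.
Variables (R : realType) (j m : nat).
Let E := {ffun 'I_m -> symmx R j}.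
Variables (a : E) (L : {vspace E}).
Implicit Types B D : E.

Let Q : set E := @psd_cone_pow R j m `&` [set x | x - a \in L].

Lemma psd_cone_powP B : psd_cone_pow B <-> forall i, psd (vsval (B i)).
Proof.
split=> [B0 i|B0 i v]; last by have [_] := B0 i; apply.
by split; [apply/eqP; rewrite -mem_symmx; exact: subvsP|exact: B0].
Qed.

Lemma vsval_sum_ffun (I : finType) (P : {pred I}) (B : I -> E) l :
  vsval ((\sum_(i in P) B i) l) = \sum_(i in P) vsval (B i l).
Proof. by rewrite sum_ffunE linear_sum. Qed.

Lemma vsval_scale_ffun (c : R) B l : vsval ((c *: B) l) = c *: vsval (B l).
Proof. by rewrite ffunE linearZ. Qed.

(** The kernels of D being contained in those of B, some multiple c1 *: D - B
    is psd in every block. The point D + e *: (D - B) then lies in the section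
    for small e > 0, and l takes the value - e * l B at it. *)
Lemma psd_cone_pow_sub_face (l : {linear E -> R^o}) D B :
  (forall B, Q B -> 0 <= l B) -> Q D -> Q B -> l D = 0 ->
  (forall i, (kermx (vsval (D i)) <= kermx (vsval (B i)))%MS) -> l B = 0.
Proof.
move=> l0 QD QB lD kDB; have [/psd_cone_powP pD LD] := QD.
have [/psd_cone_powP pB LB] := QB.
have /choice[c cP] i : exists c, 0 <= c /\
    forall v, bform (vsval (B i)) v v <= c * bform (vsval (D i)) v v.
  by have [c ? ?] := psd_dominated (pD i) (pB i).1 (kDB i); exists c.
pose c1 := \sum_i c i.
have c1_ge0 : 0 <= c1 by apply: sumr_ge0 => i _; have [] := cP i.
have c_le i : c i <= c1.
  by rewrite /c1 (bigD1 i)//= lerDl sumr_ge0// => l' _; have [] := cP l'.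
(* The point (1 + e) *: D - e *: B is psd as soon as e * c1 <= 1 + e. *)
pose e := (1 + c1)^-1.
have e_gt0 : 0 < e by rewrite invr_gt0 ltr_wpDr.
have ec : e * (1 + c1) = 1 by rewrite mulVf// gt_eqF// ltr_wpDr.
have /l0 : Q ((1 + e) *: D + - e *: B).
  split.
    apply/psd_cone_powP=> i; rewrite ffunE linearD/= !vsval_scale_ffun.
    have [sD D0] := pD i; have [sB B0] := pB i.
    split=> [|v]; first by rewrite linearD/= !linearZ/= sD sB.
    rewrite bform_addmx !bform_scalemx.
    have bB : e * bform (vsval (B i)) v v <= e * (c1 * bform (vsval (D i)) v v).
      rewrite ler_pM2l//; apply: (le_trans ((cP i).2 v)).
      by rewrite ler_wpM2r// D0.
    have := mulr_ge0 (ltW e_gt0) (D0 v); have := D0 v.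
    have : e * c1 = 1 - e by rewrite -ec; ring.
    rewrite mulrA in bB; move=> ec1; rewrite ec1 in bB; nra.
  rewrite /=.
  have -> : (1 + e) *: D + - e *: B - a = (D - a) + e *: ((D - a) - (B - a)).
    have -> : D - a - (B - a) = D - B by rewrite opprB addrA subrK.
    rewrite scalerBr scalerDl scale1r scaleNr.
    by rewrite [RHS]addrAC !addrA.
  by rewrite memvD// memvZ// memvB.
rewrite linearD/= !linearZ/= lD /GRing.scale/= mulr0 add0r mulNr oppr_ge0.
rewrite pmulr_rle0// => lB; apply/le_anti; rewrite lB; exact: l0.
Qed.

Lemma barycenter_psd_section (I : finType) (P : {pred I}) (B : I -> E) :
  (0 < #|P|)%N -> (forall i, i \in P -> Q (B i)) ->
  let D := \sum_(i in P) #|P|%:R^-1 *: B i in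
  Q D /\ forall i l, i \in P -> (kermx (vsval (D l)) <= kermx (vsval (B i l)))%MS.
Proof.
move=> P0 QB D; set c := (#|P|%:R^-1 : R).
have c_gt0 : 0 < c by rewrite invr_gt0 ltr0n.
have pB i l : i \in P -> psd (vsval ((c *: B i) l)).
  move=> /QB[/psd_cone_powP/(_ l) [sB B0] _]; rewrite vsval_scale_ffun.
  by split=> [|v]; rewrite ?linearZ/= ?sB// bform_scalemx mulr_ge0// ltW.
split; last first.
  move=> i l Pi; rewrite vsval_sum_ffun.
  have := @kermx_sum_psd _ _ I P (fun i => vsval ((c *: B i) l)) i (pB^~ l) Pi.
  move/submx_trans; apply; rewrite vsval_scale_ffun.
  apply/sub_kermxP; apply/eqP.
  have := mulmx_ker (c *: vsval (B i l)); rewrite -scalemxAr => /eqP.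
  by rewrite scaler_eq0 gt_eqF.
split.
  apply/psd_cone_powP => l; rewrite vsval_sum_ffun.
  split=> [|v].
    by rewrite linear_sum/=; apply: eq_bigr => i /(pB i l)[].
  by rewrite bform_summx; apply: sumr_ge0 => i /(pB i l)[].
rewrite /=.
have -> : D - a = \sum_(i in P) c *: (B i - a).
  under [RHS]eq_bigr do rewrite scalerBr.
  rewrite sumrB sumr_const -scaler_nat scalerA mulfV ?scale1r//.
  by rewrite pnatr_eq0 -lt0n.
by apply: memv_suml => i /QB[_ ?]; exact: memvZ.
Qed.

End Sections.

(** * Evaluation of polynomials, and the lower bound *)

Section Evaluation.
Variables (R : realType) (n e : nat) (x : 'rV[R]_n).

Definition eval_at (f : bpoly n R e) : R^o := bpoly_eval f x.

Lemma eval_at_is_linear : linear eval_at.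
Proof.
move=> a f g; rewrite /eval_at /bpoly_eval.
have -> : bpoly_val (a *: f + g) = a *: bpoly_val f + bpoly_val g.
  exact: (linearP (val : bpoly n R e -> mpoly n R)).
by rewrite mevalD mevalZ.
Qed.

HB.instance Definition _ :=
  GRing.isLinear.Build R (bpoly n R e) R^o _ eval_at eval_at_is_linear.

End Evaluation.

Lemma lt_sxdeg (R : realType) (V : lmodType R) (S : set V) (k : nat) :
  (forall j, has_psd_lift j S -> (k < j)%N) -> ((Posz k)%:E < sxdeg S)%E.
Proof.
move=> lift_gt; rewrite /sxdeg; case: pselect => [ex_j|_]; last exact: ltry.
by rewrite lte_fin ltz_nat; case: ex_minnP => j /andP[_ /asboolP/lift_gt].
Qed.

Theorem theorem2 (R : realType) (n k d : nat) (n_gt0 : (0 < n)%N)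
    (k_gt0 : (0 < k)%N) (X : set 'rV[R]_n) (X_int : X° !=set0)
    (C : set (bpoly n R (2 * d)%N))
    (C_sub : C `<=` nonneg_polys (2 * d)%N X)
    (C_closed : closed C) (C_cone : convex_cone C)
    (C_sep : forall N : nat, exists S : {fset 'rV[R]_n},
      [/\ [set` S] `<=` X, (N <= #|` S|)%N &
        forall T : {fset 'rV[R]_n}, fsubset T S -> #|` T| = k ->
          exists f : bpoly n R (2 * d)%N,
            [/\ C f,
                forall x, x \in T -> bpoly_eval f x = 0 &
                forall x, x \in S -> x \notin T -> 0 < bpoly_eval f x]]) :
  ((Posz k)%:E < sxdeg C)%E.
Proof.
apply: lt_sxdeg => j [m [_ [a [L [p CE]]]]]; rewrite ltnNge; apply/negP => jk.
(* k + 1 points: the k elements of A, and x. *)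
have [M MP] := simultaneously_spanning_subfamily R j k.+1 (enum 'I_m).
have [S [SX MS S_sep]] := C_sep M.
pose Q := @psd_cone_pow R j m `&` [set x | x - a \in L].
have p_ge0 (x : S) B : Q B -> 0 <= eval_at (val x) (p B).
  move=> QB; apply: (C_sub (p B)); first by rewrite CE; exists B.
  exact/SX/(valP x).
have /choice[B BP] (A : {set S}) : exists B, #|A| = k ->
    [/\ Q B, forall x, x \in A -> eval_at (val x) (p B) = 0 &
        forall x, x \notin A -> 0 < eval_at (val x) (p B)].
  have [Ak|] := eqVneq #|A| k; last by move=> /eqP Ak; exists 0.
  have [||f [Cf f0 f_gt0]] := S_sep [fset val x | x in A]%fset.
  - by apply/fsubsetP => _ /imfsetP[/= x _ ->]; exact: valP.
  - by rewrite card_imfset -?cardE//; exact: val_inj.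
  move: Cf; rewrite CE => -[B QB pB]; exists B => _; rewrite pB; split=> // x xA.
    by apply: f0; apply/imfsetP; exists x.
  apply: f_gt0; first exact: valP.
  by apply/imfsetP => -[/= y yA /val_inj xy]; rewrite xy yA in xA.
pose P (x : S) : {set {set S}} := [set A : {set S} | (#|A| == k) && (x \in A)]%SET.
pose D x := \sum_(A in P x) #|P x|%:R^-1 *: B A.
have [|S' [_ kS'] S'P] := MP S (fun i x => kermx (vsval (D x i))) [set: S]%SET.
  by rewrite cardsT -cardfE.
have /card_geqP[[|x s] [us sk sS']] := kS'; first by [].
move: us sk => /= /andP[xs us] [sk].
pose A := [set y in s].
have Ak : #|A| = k by rewrite cardsE (card_uniqP us).
have xA : x \notin A by rewrite inE.
have AS' : A \subset S'.
  by apply/fintype.subsetP => y; rewrite inE => ys; rewrite sS'// inE ys orbT.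
have xS' : x \in S' by rewrite sS'// mem_head.
have QB y A' : A' \in P y -> Q (B A').
  by rewrite inE => /andP[/eqP/BP[]].
(* D x averages over a nonempty family: exchange some y in A for x. *)
have Px : (0 < #|P x|)%N.
  have /card_gt0P[y yA] : (0 < #|A|)%N by rewrite Ak.
  apply/card_gt0P; exists (x |: A :\ y)%SET; rewrite inE finset.setU11 andbT.
  rewrite cardsU1 !inE negb_and (negPf xs) orbT/=.
  by rewrite -Ak (cardsD1 y A) yA.
have AP y : y \in A -> A \in P y by rewrite !inE Ak eqxx.
have [QBA BA0 BA_gt0] := BP A Ak.
have [QD _] := barycenter_psd_section Px (QB x).
have := BA_gt0 x xA; suff -> : eval_at (val x) (p (B A)) = 0 by rewrite ltxx.
apply: (psd_cone_pow_sub_face (l := eval_at (val x) \o p) (p_ge0 x) QD QBA).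
  rewrite /= !linear_sum big1// => A' A'x; rewrite !linearZ/=.
  move: A'x; rewrite inE => /andP[/eqP/BP[_ + _] xA'] => ->//.
  by rewrite scaler0.
move=> i; apply: (submx_trans (S'P i A x _ AS' _ xS')); rewrite ?mem_enum ?Ak//.
apply/sumsmx_subP => y yA.
have Py : (0 < #|P y|)%N by apply/card_gt0P; exists A; exact: AP.
have [_] := barycenter_psd_section Py (QB y); apply; exact: AP.
Qed.
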